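(* Let $C=(c_1,c_2,\dots,c_r)$ be an ordered sequence of $r\ge 1$ positive integers and let $P_C=T_{c_r}\oplus T_{c_{r-1}}\oplus\cdots\oplus T_{c_1}$ be the ordinal sum of antichains of $C$ (with $T_{c_1}$ on top and $T_{c_r}$ at the bottom). Write $g_{P_C}(q)=\sum_{s=0}^{c_1+\cdots+c_r-1}b_sq^s$ for the cumulative generating function of $P_C$. For each $0\le s<c_1+\cdots+c_r$, let $j\in\{1,\dots,r\}$ be the unique integer such that $\sum_{k=1}^{j-1}c_k\le s<\sum_{k=1}^{j}c_k$. Then $$b_s=(c_1+c_2+\cdots+c_j)!\prod_{m=j+1}^{r}\frac{(c_m+s)!}{s!}.$$
   Context: Let $P$ be a finite poset with $n$ elements. A labeling of $P$ is a bijection $L:P\to\{1,\dots,n\}$. $L$ is natural if $x<_P y$ implies $L(x)<L(y)$. The (extended) promotion $\partial L$ of a labeling $L$ is obtained as follows: (1) repeat until the element labeled $1$ is maximal: let $u$ be the element labeled $1$ and let $v$ be the element with the smallest label among all elements $v>_P u$; swap the labels of $u$ and $v$; (2) then simultaneously replace the label $1$ by $n$ and each label $i>1$ by $i-1$. The order of $L$ is the smallest $k\ge 0$ such that $\partial^k L$ is natural (it is known that the order is always at most $n-1$). The cumulative generating function of an $n$-element poset $P$ is $g_P(q)=\sum_{i=0}^{n-1}b_iq^i$, where $b_i=a_0+a_1+\cdots+a_i$ and $a_i$ is the number of labelings of $P$ of order exactly $i$. $T_k$ denotes the antichain on $k$ elements. The ordinal sum $P\oplus Q$ is the poset on the disjoint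 union $P\sqcup Q$ in which $s\le t$ iff $s,t\in P$ and $s\le_P t$, or $s,t\in Q$ and $s\le_Q t$, or $s\in P$ and $t\in Q$ (so $P$ lies below $Q$). *)

(* Defs.v *)
From HB Require Import structures.
From mathcomp Require Import all_boot all_order all_algebra all_fingroup.

Set Implicit Arguments.
Unset Strict Implicit.
Unset Printing Implicit Defensive.

Fact ordsum_display : Order.disp_t. Proof. exact: Order.Disp tt tt. Qed.

(* A type alias carrying the discrete order, instead of the usual order
   of 'I_k. *)
Definition antichain (k : nat) : Type := 'I_k.

HB.instance Definition _ (k : nat) := Finite.copy (antichain k) 'I_k.

Section Antichain.
Variable k : nat.
Definition antichain_le : rel (antichain k) := fun x y => x == y.

Fact antichain_le_refl : reflexive antichain_le.
Proof. by move=> x; apply: eqxx. Qed.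
Fact antichain_le_anti : antisymmetric antichain_le.
Proof. by move=> x y /andP[/eqP]. Qed.
Fact antichain_le_trans : transitive antichain_le.
Proof. by move=> y x z /eqP-> /eqP->; apply: eqxx. Qed.

HB.instance Definition _ := Order.Le_isPOrder.Build ordsum_display
  (antichain k) antichain_le_refl antichain_le_anti antichain_le_trans.
End Antichain.

Definition ordsum (P Q : Type) : Type := (P + Q)%type.

HB.instance Definition _ (P Q : finType) :=
  Finite.copy (ordsum P Q) (P + Q)%type.

Section OrdinalSum.
Variables (d1 d2 : Order.disp_t).
Variables (P : finPOrderType d1) (Q : finPOrderType d2).

Definition ordsum_le : rel (ordsum P Q) := fun s t =>
  match s, t with
  | inl x, inl y => (x <= y)%O
  | inr x, inr y => (x <= y)%O
  | inl _, inr _ => true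
  | inr _, inl _ => false
  end.

Fact ordsum_le_refl : reflexive ordsum_le.
Proof. by case=> x /=; apply: Order.POrderTheory.lexx. Qed.
Fact ordsum_le_anti : antisymmetric ordsum_le.
Proof.
by case=> x [] y //= /Order.POrderTheory.le_anti ->.
Qed.
Fact ordsum_le_trans : transitive ordsum_le.
Proof. by case=> y [] x [] z //=; apply: Order.POrderTheory.le_trans. Qed.

HB.instance Definition _ := Order.Le_isPOrder.Build ordsum_display
  (ordsum P Q) ordsum_le_refl ordsum_le_anti ordsum_le_trans.
End OrdinalSum.

(* The head of C is the top antichain.  The value on the empty sequence is
   a dummy: singletons are treated separately so that no empty antichain
   occurs in the sum. *)
Fixpoint antichain_sum (C : seq nat) : finPOrderType ordsum_display :=
  match C with
  | [::] => antichain 0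
  | [:: c] => antichain c
  | c :: C' => ordsum (antichain_sum C') (antichain c)
  end.

Section Promotion.
Variables (d : Order.disp_t) (P : finPOrderType d).

(* Labels are 0-based: the ordinal i : 'I_#|P| stands for the label i + 1. *)
Implicit Type L : {ffun P -> 'I_#|P|}.

Definition is_labeling L : bool :=
  injectiveb L && [forall i, i \in codom L].

Definition is_natural L : bool :=
  [forall x : P, forall y : P, (x < y)%O ==> (L x < L y)%N].

Definition swap_labels L (u v : P) : {ffun P -> 'I_#|P|} :=
  [ffun x => L (tperm u v x)].

Definition slide_step L : {ffun P -> 'I_#|P|} :=
  if [pick u | val (L u) == 0%N] is Some u then
    if [pick v | (u < v)%O
               & [forall w : P, (u < w)%O ==> (L v <= L w)%N]] is Some v
    then swap_labels L u v
    else L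
  else L.

(* Each effective slide moves the label 0 strictly up in P and slide_step is
   the identity once label 0 is on a maximal element, so #|P| iterations
   reach the end of the process.  ord_pred sends 0 to #|P| - 1 and i > 0 to
   i - 1. *)
Definition promotion L : {ffun P -> 'I_#|P|} :=
  [ffun x => ord_pred (iter #|P| slide_step L x)].

Definition has_order L (k : nat) : bool :=
  is_natural (iter k promotion L)
  && [forall i : 'I_k, ~~ is_natural (iter i promotion L)].

Definition num_order (i : nat) : nat :=
  #|[set L : {ffun P -> 'I_#|P|} | is_labeling L & has_order L i]|.

Definition num_order_le (i : nat) : nat := (\sum_(0 <= k < i.+1) num_order k)%N.

Definition cumulative_gf : {poly nat} := (\poly_(i < #|P|) num_order_le i)%R.
End Promotion.

(* Main.v *)
Require Import Defs.
From HB Require Import structures.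
From mathcomp Require Import all_boot all_order all_algebra all_fingroup.
From mathcomp Require Import zify.

Set Implicit Arguments.
Unset Strict Implicit.
Unset Printing Implicit Defensive.

Import Order.POrderTheory.

(** The order of a labeling of an ordinal sum of antichains can be read off
    the labeling without computing any promotion. Write D(x) for the set of
    elements that are not above x. Then the s-th promotion of a labeling L is
    natural if and only if L x < #|D(x)| + s for all x, labels being counted
    from 0. For s = 0 the inequalities force L to fill the sets D(x), which
    form a chain, from the bottom up (near_natural0). For the passage from s
    to s + 1, consider the largest label outside the set F of elements above
    x. All elements outside F lie below all of F, so a slide changes the set
    of labels outside F only when the label 0 enters F; it is then exchanged
    for the smallest label of F, which is at most #|D(x)| because all labels
    of F are at least as large. Hence the statement that all labels outside F
    are at most t is invariant under sliding as soon as t >= #|D(x)|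
    (slide_step_bound), and the final decrement of the labels turns t into
    t - 1 (near_natural_promotion).

    Since the inequalities weaken as s grows, b_s is the number of injective
    L that satisfy them (num_order_leE). Such L are counted by choosing the
    labels level by level from the bottom: the bounds increase, so every
    label used at a lower level is also below the bound of the next one. A
    level of c elements with a elements below it therefore contributes the
    falling factorial (min(n, a + c + s) - a) ^_ c
    (card_near_labelings_ordsum). For the levels up to j, counted from the
    top, the minimum is n and the factors telescope to a factorial
    (prod_ffact_psum); for the others it is a + c + s and the factor is
    (c + s)! / s!. *)

(** * Near-natural labelings of weak orders *)

Definition above (d : Order.disp_t) (P : finPOrderType d) (x : P) : {set P} :=
  [set y | (x < y)%O].

(** Negative transitivity of the strict order. Unlike the shape of an ordinal
    sum, it can be used without a recursion on the summands. *)
Definition weak_order (d : Order.disp_t) (P : finPOrderType d) : Prop :=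
  forall x y z : P, (x < y)%O -> (x < z)%O || (z < y)%O.

(** The inequality that characterizes order at most s. The number n of labels
    is kept independent of P, since the count proceeds through ordinal
    summands of P. *)
Definition near_natural (d : Order.disp_t) (P : finPOrderType d) (n s : nat)
    (L : {ffun P -> 'I_n}) : bool :=
  [forall x, L x < #|~: above x| + s].

Definition near_labelings (d : Order.disp_t) (P : finPOrderType d) (n s : nat)
    : {set {ffun P -> 'I_n}} :=
  [set L : {ffun P -> 'I_n} | injectiveb L & near_natural s L].

Section Above.
Variables (d : Order.disp_t) (P : finPOrderType d).
Implicit Types x y z : P.

Lemma card_nabove_lt x y : (x < y)%O -> #|above y| < #|above x|.
Proof.
move=> ltxy; apply: proper_card; apply/properP; split.
  by apply/subsetP=> z; rewrite !inE; apply: lt_trans.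
by exists y; rewrite !inE ?ltxx.
Qed.

Hypothesis weakP : weak_order P.

Lemma weak_order_nabove x y z :
  z \notin above x -> y \in above x -> (z < y)%O.
Proof. by rewrite !inE => /negPf nxz /(weakP z); rewrite nxz. Qed.

Lemma leq_card_nabove x z :
  z \notin above x -> #|~: above z| <= #|~: above x|.
Proof.
move=> nxz; rewrite subset_leq_card // setCS; apply/subsetP=> y.
by move=> /(weak_order_nabove nxz); rewrite inE.
Qed.

(** As the sets of non-above elements form a chain, the bound at x also holds
    for the label of every element that is not above x; promotion is analysed
    in this form. *)
Lemma near_natural_nabove n s (L : {ffun P -> 'I_n}) :
  reflect (forall x z, z \notin above x -> L z < #|~: above x| + s)
          (near_natural s L).
Proof.
apply: (iffP forallP) => [H x z nxz | H x].
  by apply: leq_trans (H z) _; rewrite leq_add2r leq_card_nabove.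
by apply: H; rewrite inE ltxx.
Qed.

End Above.


(** * Pigeonhole bounds for labels *)

Section Pigeonhole.
Variables (T : finType) (n : nat) (L : T -> 'I_n).
Hypothesis injL : injective L.

Lemma card_ord_lt b : #|[set i : 'I_n | i < b]| = minn n b.
Proof.
rewrite -sum1dep_card (eq_bigl (fun i : 'I_n => true && (i < b))) //.
have [le_bn|lt_nb] := leqP b n.
  rewrite (eq_bigl (fun i : 'I_n => i < b)) //.
  by rewrite -(big_ord_widen _ (fun=> 1)) // sum1_card card_ord.
rewrite (eq_bigl xpredT) ?sum1_card ?card_ord // => i.
exact: ltn_trans (ltn_ord i) lt_nb.
Qed.

Lemma leq_card_labels_lt (A : {set T}) b :
  (forall x, x \in A -> L x < b) -> #|A| <= b.
Proof.
move=> ltA; rewrite -(card_imset _ injL).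
apply: leq_trans (geq_minr n b); rewrite -card_ord_lt subset_leq_card //.
by apply/subsetP=> _ /imsetP[x /ltA ltx ->]; rewrite inE.
Qed.

Lemma leq_card_labels_ge (A : {set T}) m :
  m <= n -> (forall x, x \in A -> m <= L x) -> m + #|A| <= n.
Proof.
move=> le_mn geA; rewrite -(card_imset _ injL).
have sub : L @: A \subset ~: [set i : 'I_n | i < m].
  by apply/subsetP=> _ /imsetP[x /geA gex ->]; rewrite !inE -leqNgt.
have := subset_leq_card sub; have := cardsC [set i : 'I_n | i < m].
by rewrite card_ord_lt card_ord; lia.
Qed.
End Pigeonhole.

(** * Slides, promotion and the order of a labeling *)

Section Labelings.
Variables (d : Order.disp_t) (P : finPOrderType d).
Implicit Type L : {ffun P -> 'I_#|P|}.

Lemma is_labelingE L : is_labeling L = injectiveb L.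
Proof.
rewrite /is_labeling andb_idr // => /injectiveP injL.
by apply/forallP=> i; apply: inj_card_onto; rewrite ?card_ord.
Qed.

Lemma exists_label0 L : injective L -> 0 < #|P| ->
  exists u, L u = 0 :> nat.
Proof.
move=> injL P_gt0; have /codomP[u Lu] : Ordinal P_gt0 \in codom L.
  by apply: inj_card_onto; rewrite ?card_ord.
by exists u; rewrite -Lu.
Qed.

Lemma slide_stepP L u : injective L -> L u = 0 :> nat ->
     above u = set0 /\ slide_step L = L
  \/ exists v, [/\ v \in above u, forall w, w \in above u -> L v <= L w
                 & slide_step L = swap_labels L u v].
Proof.
move=> injL Lu0; rewrite /slide_step.
case: pickP => [u' /eqP Lu'0|/(_ u)]; last by move/eqP; rewrite /= Lu0.
have ->: u' = u by apply/injL/val_inj; rewrite Lu'0 /= -Lu0.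
case: pickP => [v /andP[ltuv /forallP minv]|none].
  right; exists v; split; rewrite ?inE // => w.
  by rewrite inE; apply/implyP/minv.
left; split=> //; apply/eqP/set0Pn=> -[v]; rewrite inE => ltuv.
pose Pu w := (u < w)%O.
have [w ltuw minw] := @arg_minnP _ v Pu (fun w => val (L w)) ltuv.
have := none w; rewrite /= -/(Pu w) ltuw => /forallPn[w'].
by rewrite negb_imply => /andP[ltuw' /negP[]]; apply: minw.
Qed.

Lemma slide_step_inj L : injective L -> injective (slide_step L).
Proof.
move=> injL; rewrite /slide_step; case: pickP => // u _; case: pickP => // v _.
by move=> x y; rewrite !ffunE => /injL /perm_inj.
Qed.

Lemma iter_slide_step_inj L k :
  injective L -> injective (iter k (@slide_step d P) L).
Proof. by move=> injL; elim: k => //= k; apply: slide_step_inj. Qed.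

Lemma promotion_inj L : injective L -> injective (promotion L).
Proof.
move=> injL x y; rewrite !ffunE => /ord_pred_inj.
exact: iter_slide_step_inj.
Qed.

(** The strict up-set of the carrier of label 0 shrinks at each effective
    slide; for k = #|P| this puts label 0 on a maximal element. *)
Lemma iter_slide_step_label0 L k : injective L -> 0 < #|P| ->
  exists2 u, iter k (@slide_step d P) L u = 0 :> nat & #|above u| <= #|P| - k.
Proof.
move=> injL P_gt0; elim: k => [|k [u Lu0 le_u]].
  have [u Lu0] := exists_label0 injL P_gt0; exists u => //.
  by rewrite subn0 max_card.
have [[u_max eqL]|[v [uv _ eqL]]] :=
    slide_stepP (iter_slide_step_inj (k := k) injL) Lu0; rewrite /= eqL.
  by exists u; rewrite // u_max cards0.
exists v; first by rewrite ffunE tpermR.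
have leq_subS a b m : a < b -> b <= m - k -> a <= m - k.+1 by lia.
by apply: leq_subS le_u; apply: card_nabove_lt; rewrite inE in uv.
Qed.

Hypothesis weakP : weak_order P.

(** Outside F = above x, a slide either permutes the labels or exchanges the
    label 0 for the least label of F. That least label is at most
    #|P| - #|F| = #|~: above x|, so neither it nor 0 affects the bound t. *)
Lemma slide_step_bound L x t : injective L -> #|~: above x| <= t ->
      (forall z, z \notin above x -> L z <= t)
  <-> (forall z, z \notin above x -> slide_step L z <= t).
Proof.
move=> injL le_t.
have [|u Lu0] := exists_label0 injL; first by apply/card_gt0P; exists x.
have [[_ ->] //|[v [uv minv ->]]] := slide_stepP injL Lu0.
have upF w w' : w \in above x -> (w < w')%O -> w' \in above x.
  by rewrite !inE; apply: lt_trans.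
have ltuv : (u < v)%O by rewrite inE in uv.
have [vF|vF] := boolP (v \in above x); last first.
  (* The slide stays outside above x, where it permutes the labels. *)
  have uF : u \notin above x by apply: contra vF => /upF; apply.
  have tF z : z \notin above x -> tperm u v z \notin above x.
    by case: tpermP => // ->.
  split=> H z zF; first by rewrite ffunE; apply/H/tF.
  by have := H _ (tF z zF); rewrite ffunE tpermK.
(* If label 0 enters above x, then v carries the least label of above x. *)
have le_vt : u \notin above x -> L v <= t.
  move=> uF; apply: leq_trans le_t.
  rewrite -(leq_add2l #|above x|) cardsC addnC.
  apply: (leq_card_labels_ge injL) => [|w]; first exact: ltnW.
  by move=> /(weak_order_nabove weakP uF) ltuw; apply: minv; rewrite inE.
split=> H z zF.
  rewrite ffunE; case: tpermP => [zu|zv|_ _]; last exact: H.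
    by apply: le_vt; rewrite -zu.
  by rewrite zv vF in zF.
have := H z zF; rewrite ffunE; case: tpermP => // [->|zv]; first by rewrite Lu0.
by rewrite zv vF in zF.
Qed.

(** When sliding ends, label 0 sits on a maximal element, hence in above x
    unless that set is empty. So outside above x the final relabeling only
    subtracts 1. *)
Lemma promotion_bound L x t : injective L -> #|~: above x| <= t ->
      (forall z, z \notin above x -> L z <= t)
  <-> (forall z, z \notin above x -> promotion L z < t).
Proof.
move=> injL le_t.
(* If x is maximal, then t >= #|P| and both bounds hold for all labels. *)
have [F0|/set0Pn[y yF]] := eqVneq (above x) set0.
  rewrite F0 setC0 cardsT in le_t.
  by split=> _ z _; [|apply: ltnW]; apply: leq_trans (ltn_ord _) le_t.
pose M k := iter k (@slide_step d P) L.
have step k : (forall z, z \notin above x -> L z <= t)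
          <-> (forall z, z \notin above x -> M k z <= t).
  elim: k => [|k ->] //=; apply: slide_step_bound => //.
  exact: iter_slide_step_inj.
rewrite (step #|P|).
have [|u Mu0] := @iter_slide_step_label0 L #|P| injL.
  by apply/card_gt0P; exists x.
rewrite subnn leqn0 cards_eq0 => /eqP u_max.
have Mz z : z \notin above x -> promotion L z = (M #|P| z).-1 :> nat /\ 0 < M #|P| z.
  move=> zF; have Mz_gt0 : 0 < M #|P| z.
    rewrite lt0n; apply/eqP=> Mz0.
    have zu : z = u.
      by apply: (iter_slide_step_inj (k := #|P|) injL); apply: val_inj; rewrite /= Mz0.
    have := weak_order_nabove weakP zF yF; rewrite zu => ltuy.
    by move/setP/(_ y): u_max; rewrite !inE ltuy.
  split=> //; rewrite ffunE /= -/(M #|P|).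
  have := ltn_ord (M #|P| z); move: Mz_gt0.
  case: (nat_of_ord _) => // m _ ltm.
  by rewrite addSn /= modnDr modn_small // ltnW.
by split=> H z zF; have [] := Mz z zF; have := H z zF; lia.
Qed.

Lemma near_natural_promotion L s : injective L ->
  near_natural s (promotion L) = near_natural s.+1 L.
Proof.
move=> injL; apply/(near_natural_nabove weakP)/(near_natural_nabove weakP) => H x.
  move=> z zF; rewrite addnS ltnS; move: z zF.
  by apply/promotion_bound; rewrite ?leq_addr // => z /H.
apply/promotion_bound; rewrite ?leq_addr // => z /H.
by rewrite addnS ltnS.
Qed.

Lemma near_natural0 L : injective L -> near_natural 0 L = is_natural L.
Proof.
move=> injL; apply/idP/forallP => [/(near_natural_nabove weakP) H x|H].
  apply/forallP=> y; apply/implyP=> ltxy; rewrite ltnNge; apply/negP=> leyx.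
  have Lx : L x < #|~: above x| by rewrite -[X in _ < X]addn0 H // inE ltxx.
  (* Otherwise y and the elements not above x share #|~: above x| labels. *)
  suff: #|y |: ~: above x| <= #|~: above x|.
    by rewrite cardsU1 !inE ltxy ltnn.
  apply: (leq_card_labels_lt injL) => z; rewrite !inE.
  case/predU1P=> [->|zF]; first exact: leq_ltn_trans Lx.
  by rewrite -[X in _ < X]addn0 H // inE.
(* The labels of above x are all larger than L x, so they leave room for it. *)
apply/forallP=> x; rewrite addn0 -(leq_add2l #|above x|) cardsC addnC.
apply: (leq_card_labels_ge injL (ltn_ord (L x))) => y.
by rewrite inE => ltxy; apply: (implyP (forallP (H x) y)).
Qed.

Lemma natural_iter_promotion L k : injective L ->
  is_natural (iter k (@promotion d P) L) = near_natural k L.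
Proof.
elim: k L => [|k IHk] L injL; first by rewrite near_natural0.
by rewrite iterSr IHk ?near_natural_promotion //; apply: promotion_inj.
Qed.

Lemma near_naturalW (n : nat) (L : {ffun P -> 'I_n}) s s' :
  s <= s' -> near_natural s L -> near_natural s' L.
Proof.
move=> le_s /forallP H; apply/forallP=> x.
by apply: leq_trans (H x) _; rewrite leq_add2l.
Qed.

(** Order exactly s + 1 means near-natural at s + 1 but not at s, so the
    sets counted by num_order are the increments of an increasing family. *)
Lemma num_order_leE s : num_order_le P s = #|near_labelings P #|P| s|.
Proof.
rewrite /num_order_le; elim: s => [|s IHs].
  rewrite big_nat1; apply: eq_card => L; rewrite !inE is_labelingE.
  apply: andb_id2l => /injectiveP injL.
  rewrite /has_order natural_iter_promotion // andb_idr // => _.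
  by apply/forallP=> -[].
rewrite big_nat_recr //= {}IHs -cardsUI.
rewrite [X in _ + #|pred_of_set X|](_ : _ = set0) ?cards0 ?addn0; last first.
  apply/setP=> L; rewrite !inE is_labelingE.
  apply/negP=> /andP[/andP[/injectiveP injL Ls] /and3P[_ _ /forallP/(_ ord_max)]].
  by rewrite natural_iter_promotion ?Ls.
apply: eq_card => L; rewrite !inE is_labelingE -andb_orr.
apply: andb_id2l => /injectiveP injL.
rewrite /has_order natural_iter_promotion //.
have [Ls|nLs] /= := boolP (near_natural s L).
  by rewrite (near_naturalW _ Ls).
rewrite andb_idr // => _; apply/forallP=> i; rewrite natural_iter_promotion //.
by apply: contra nLs; apply: near_naturalW; rewrite -ltnS.
Qed.
End Labelings.

(** * Counting near-natural labelings of ordinal sums *)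

Section OrdinalSums.
Variables (d1 d2 : Order.disp_t).
Variables (P : finPOrderType d1) (Q : finPOrderType d2).

Lemma ordsum_ltE (x y : ordsum P Q) : (x < y)%O =
  match x, y with
  | inl a, inl b => (a < b)%O
  | inr a, inr b => (a < b)%O
  | inl _, inr _ => true
  | inr _, inl _ => false
  end.
Proof. by case: x y => x [] y; rewrite lt_neqAle // [RHS]lt_neqAle. Qed.

Lemma weak_order_ordsum :
  weak_order P -> weak_order Q -> weak_order (ordsum P Q).
Proof.
by move=> wP wQ [x|x] [y|y] [z|z]; rewrite !ordsum_ltE ?orbT //; [apply: wP|apply: wQ].
Qed.

Lemma card_ordsum : #|{: ordsum P Q}| = #|P| + #|Q|.
Proof. exact: card_sum. Qed.

Lemma card_nabove_inl (x : P) :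
  #|~: above (inl x : ordsum P Q)| = #|~: above x|.
Proof.
rewrite -!sum1_card [LHS]big_sumType /= [X in _ + X]big_pred0 ?addn0.
  by apply: eq_bigl => y; rewrite !inE ordsum_ltE.
by move=> y; rewrite !inE ordsum_ltE.
Qed.

Lemma card_nabove_inr (x : Q) :
  #|~: above (inr x : ordsum P Q)| = #|P| + #|~: above x|.
Proof.
rewrite -!sum1_card [LHS]big_sumType /=; congr (_ + _).
  by apply: eq_bigl => y; rewrite !inE ordsum_ltE.
by apply: eq_bigl => y; rewrite !inE ordsum_ltE.
Qed.
End OrdinalSums.

Lemma antichain_ltE k (x y : antichain k) : (x < y)%O = false.
Proof. by rewrite lt_neqAle andNb. Qed.

Lemma weak_order_antichain k : weak_order (antichain k).
Proof. by move=> x y z; rewrite antichain_ltE. Qed.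

Lemma card_nabove_antichain k (x : antichain k) : #|~: above x| = k.
Proof.
rewrite (_ : ~: _ = setT) ?cardsT ?card_ord //.
by apply/setP=> y; rewrite !inE antichain_ltE.
Qed.

Lemma card_near_labelings_antichain c n s :
  #|near_labelings (antichain c) n s| = (minn n (c + s)) ^_ c.
Proof.
rewrite -card_ord_lt -[X in _ = _ ^_ X](card_ord c) -card_inj_ffuns_on.
apply: eq_card => f; rewrite !inE andbC; congr (_ && _).
apply/forallP/ffun_onP => H x; have := H x;
  by rewrite card_nabove_antichain !inE.
Qed.

(** The labels of P obey bounds at most #|P| + s, hence all lie below the
    common bound #|P| + c + s of the antichain on top. So every choice on P
    leaves the same number of labels for the antichain. *)
Lemma card_near_labelings_ordsum d (P : finPOrderType d) c n s :
  #|near_labelings (ordsum P (antichain c)) n s|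
  = #|near_labelings P n s| * (minn n (#|P| + c + s) - #|P|) ^_ c.
Proof.
set b := #|P| + c + s.
pose glue (p : {ffun P -> 'I_n} * {ffun antichain c -> 'I_n}) :
    {ffun ordsum P (antichain c) -> 'I_n} :=
  [ffun x => match x with inl y => p.1 y | inr y => p.2 y end].
have glue_inj : injective glue.
  move=> [f g] [f' g'] /ffunP eqG; congr (_, _); apply/ffunP=> x.
    by have := eqG (inl x); rewrite !ffunE.
  by have := eqG (inr x); rewrite !ffunE.
pose free (f : {ffun P -> 'I_n}) : {set 'I_n} :=
  [set i : 'I_n | i < b] :\: [set f x | x : P].
pose ext f := [set g : {ffun antichain c -> 'I_n} in ffun_on (mem (free f)) | injectiveb g].
have card_ext f : f \in near_labelings P n s ->
    #|ext f| = (minn n b - #|P|) ^_ c.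
  rewrite inE => /andP[/injectiveP injf /forallP boundf].
  rewrite card_inj_ffuns_on card_ord cardsD card_ord_lt (setIidPr _).
    by rewrite card_imset.
  apply/subsetP=> _ /imsetP[x _ ->]; rewrite inE.
  apply: leq_trans (boundf x) _; rewrite leq_add2r.
  by apply: leq_trans (max_card _) (leq_addr _ _).
have -> : near_labelings (ordsum P (antichain c)) n s
        = glue @: [set p | (p.1 \in near_labelings P n s) && (p.2 \in ext p.1)].
  apply/setP=> h; apply/idP/imsetP => [|[[f g]]].
    rewrite inE => /andP[/injectiveP injh /forallP boundh].
    exists ([ffun x => h (inl x)], [ffun x => h (inr x)]); last first.
      by apply/ffunP=> -[x|x]; rewrite !ffunE.
    rewrite !inE /=; apply/and3P; split.
    - apply/andP; split; first by apply/injectiveP=> x y; rewrite !ffunE => /injh[].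
      apply/forallP=> x; have := boundh (inl x).
      by rewrite ffunE card_nabove_inl.
    - apply/ffun_onP=> x; rewrite !inE ffunE.
      have := boundh (inr x); rewrite card_nabove_inr card_nabove_antichain => ->.
      by rewrite andbT; apply/imsetP=> -[y _]; rewrite ffunE => /injh.
    - by apply/injectiveP=> x y; rewrite !ffunE => /injh[].
  rewrite !inE /= => /and3P[/andP[/injectiveP injf /forallP boundf]].
  move=> /ffun_onP extg /injectiveP injg ->.
  have fg x y : f x != g y.
    apply/eqP=> eq_fg; have := extg y; rewrite !inE -eq_fg.
    by rewrite imset_f.
  apply/andP; split.
    apply/injectiveP=> -[x|x] [y|y]; rewrite !ffunE /=.
    - by move/injf->.
    - by move/eqP; rewrite (negPf (fg _ _)).
    - by move/esym/eqP; rewrite (negPf (fg _ _)).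
    - by move/injg->.
  apply/forallP=> -[x|x]; rewrite ffunE /=.
    by rewrite card_nabove_inl.
  rewrite card_nabove_inr card_nabove_antichain.
  by have := extg x; rewrite !inE => /andP[].
rewrite card_imset // -sum1dep_card.
rewrite -(pair_big_dep (mem (near_labelings P n s)) (fun f g => g \in ext f)
  (fun _ _ => 1)) /=.
rewrite (eq_bigr (fun=> (minn n b - #|P|) ^_ c)); last first.
  by move=> f /card_ext <-; rewrite sum1_card.
by rewrite sum_nat_const.
Qed.

(** * Ordinal sums of antichains *)

Lemma antichain_sum_cons c C : 0 < size C ->
  antichain_sum (c :: C) = ordsum (antichain_sum C) (antichain c).
Proof. by case: C. Qed.

Lemma weak_order_antichain_sum C : weak_order (antichain_sum C).
Proof.
elim: C => [|c [|c' C] IHC]; [exact: weak_order_antichain..|].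
by apply: weak_order_ordsum IHC _; apply: weak_order_antichain.
Qed.

Lemma card_antichain_sum C : #|{: antichain_sum C}| = sumn C.
Proof.
elim: C => [|c [|c' C] IHC]; first by rewrite card_ord.
  by rewrite card_ord /= addn0.
by rewrite [LHS]card_ordsum IHC card_ord addnC.
Qed.

Lemma card_near_labelings_antichain_sum C n s :
  #|near_labelings (antichain_sum C) n s| =
  \prod_(0 <= m < size C)
     (minn n (sumn (drop m C) + s) - sumn (drop m.+1 C)) ^_ (nth 0 C m).
Proof.
elim: C => [|c C IHC].
  by rewrite [LHS]card_near_labelings_antichain ffactn0 big_geq.
rewrite [RHS]big_nat_recl // [drop 1 _]/= !drop0; have [/size0nil->|C_gt0] := posnP (size C).
  by rewrite [LHS]card_near_labelings_antichain big_geq //= addn0 subn0 muln1.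
rewrite antichain_sum_cons // card_near_labelings_ordsum IHC card_antichain_sum.
by rewrite mulnC (addnC (sumn C)).
Qed.

Section PartialSums.
Variable C : seq nat.
Let psum i := \sum_(0 <= k < i) nth 0 C k.

Lemma psumS i : psum i.+1 = psum i + nth 0 C i.
Proof. by rewrite /psum big_nat_recr. Qed.

Lemma leq_psum i j : i <= j -> psum i <= psum j.
Proof. by move=> le_ij; rewrite /psum (big_cat_nat _ le_ij) //= leq_addr. Qed.

Lemma sumn_drop i : psum i + sumn (drop i C) = sumn C.
Proof.
elim: i => [|i IHi]; first by rewrite /psum big_geq // drop0.
rewrite psumS -IHi -addnA; congr (_ + _).
have [lt_i|le_i] := ltnP i (size C); first by rewrite (drop_nth 0 lt_i).
by rewrite nth_default // (drop_oversize le_i) drop_oversize // leqW.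
Qed.

(** Both sides count the ways to order psum i objects, block by block, the
    last block first. *)
Lemma prod_ffact_psum i :
  \prod_(0 <= m < i) (psum m.+1) ^_ (nth 0 C m) = (psum i)`!.
Proof.
elim: i => [|i IHi]; first by rewrite /psum !big_geq.
rewrite big_nat_recr //= IHi mulnC psumS.
by rewrite -(ffact_fact (leq_addl (psum i) _)) addnK.
Qed.
End PartialSums.

Theorem proposition6p1 (C : seq nat) (hr : (1 <= size C)%N)
    (hC : all (fun c => 0 < c)%N C)
    (s : nat) (hs : (s < \sum_(0 <= k < size C) nth 0 C k)%N) :
  exists2 j : nat,
    unique (fun i : nat => (i < size C)%N /\
      (\sum_(0 <= k < i) nth 0 C k <= s < \sum_(0 <= k < i.+1) nth 0 C k)%N) j
    & ((cumulative_gf (antichain_sum C))`_s)%R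
      = ((\sum_(0 <= k < j.+1) nth 0 C k)`!
         * \prod_(j.+1 <= m < size C) ((nth 0 C m + s)`! %/ s`!))%N.
Proof.
pose psum i := \sum_(0 <= k < i) nth 0 C k.
have psum_size : psum (size C) = sumn C.
  by rewrite -(sumn_drop C (size C)) drop_size addn0.
have ex_j : exists i, s < psum i by exists (size C).
case: (ex_minnP ex_j) => -[|j] lt_s min_j; first by rewrite /psum big_geq in lt_s.
have le_s : psum j <= s by rewrite leqNgt; apply/negP=> /min_j; rewrite ltnn.
have lt_j : j < size C by apply: min_j.
exists j.
  split=> [|i [_ /andP[le_is lt_si]]]; first by split=> //; apply/andP.
  have := leq_psum C (i := i.+1) (j := j); have := leq_psum C (i := j.+1) (j := i).
  rewrite -/(psum i) -/(psum j) -/(psum i.+1) -/(psum j.+1) in le_is lt_si *.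
  by lia.
rewrite coef_poly card_antichain_sum -psum_size hs.
rewrite num_order_leE; last exact: weak_order_antichain_sum.
rewrite card_near_labelings_antichain_sum card_antichain_sum.
(* The minimum is n for m <= j, where psum m <= s, and n - psum m + s for
   m > j, where s < psum m. *)
rewrite (big_cat_nat _ (n := j.+1)) //=; congr (_ * _).
  rewrite -prod_ffact_psum; apply: eq_big_nat => m /andP[_ le_mj].
  congr (_ ^_ _).
  have := sumn_drop C m; have := sumn_drop C m.+1.
  have := leq_psum C (i := m) (j := j).
  rewrite -/(psum m) -/(psum j) -/(psum m.+1).
  by lia.
apply: eq_big_nat => m /andP[lt_jm _].
rewrite -[X in _ %/ X`!](addKn (nth 0 C m) s) -ffact_factd ?leq_addr //.
congr (_ ^_ _).
have := sumn_drop C m; have := sumn_drop C m.+1; rewrite psumS.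
have := leq_psum C (i := j.+1) (j := m).
rewrite -/(psum m) -/(psum j.+1).
by lia.
Qed.
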